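(* Let $\pi_\theta$ be a policy returned by the training procedure (Algorithm 1) described in the context, and let $\mathcal{X}_{0,\theta}=\{x\in\mathcal{X} \mid \pi_\theta(x)\neq-1\}$. Then $J\big(x,\pi_\theta(x)\big)<\infty$ for all $x\in\mathcal{X}_{0,\theta}$.
   Context: Conventions. A polytope is the intersection of finitely many (open or closed) halfspaces. Sets form a convex partition of $S$ if they are nonempty, pairwise disjoint polytopes with union $S$. $\bar S$ is the closure of $S$. For a bounded polytope $S$, $\mathrm{Vert}(S)$ is the set of vertices (extreme points of $\bar S$). $\ominus$ is the Pontryagin difference, $S\ominus T=\{x\mid x+t\in S\ \forall t\in T\}$. System. $\mathcal{X}\subseteq\mathbb{R}^n$ and $\mathcal{U}\subseteq\mathbb{R}^m$ are compact polytopes with the origin in their interior. $\{P_i\}_{i\in\mathcal{L}}$, $\mathcal{L}=\{1,\dots,l\}$, is a convex partition of $\mathcal{X}$. The piecewise affine dynamics are $x(k+1)=A_ix(k)+Bu(k)+c_i$ for $x(k)\in P_i$, with $A_i\in\mathbb{R}^{n\times n}$, $B\in\mathbb{R}^{n\times m}$, $c_i\in\mathbb{R}^n$; they are continuous: $A_ix+Bu+c_i=A_jx+Bu+c_j$ for all $x\in\bar P_i\cap\bar P_j$ and all $u$. The terminal set $\mathcal{X}_{\mathrm f}\subseteq\mathcal{X}$ is a polytope containing the origin in its interior, positive invariant under linear control laws: for every $i$ with $P_i\cap\mathcal{X}_{\mathrm f}\ne\emptyset$ there is $K_i\in\mathbb{R}^{m\times n}$ such that for all $x\in P_i\cap\mathcal{X}_{\mathrm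 f}$, $K_ix\in\mathcal{U}$ and $A_ix+BK_ix+c_i\in\mathcal{X}_{\mathrm f}$. In the optimization problems below $\mathcal{X}_{\mathrm f}$ is closed. Optimal control problem. Fix a horizon $N\ge1$. For $x\in\mathbb{R}^n$ and a switching sequence $\bm{\delta}=(\delta(0),\dots,\delta(N))\in\{1,\dots,l\}^{N+1}$, let $$J(x,\bm{\delta})=\min_{\mathbf{x},\mathbf{u}}J(\mathbf{x},\mathbf{u})$$ over $\mathbf{x}=(x(0),\dots,x(N))$, $\mathbf{u}=(u(0),\dots,u(N-1))$ subject to: $x(0)=x$; $x(k+1)=A_{\delta(k)}x(k)+Bu(k)+c_{\delta(k)}$ for $k=0,\dots,N-1$; $x(k)\in\bar P_{\delta(k)}$ for $k=0,\dots,N$; $(x(k),u(k))\in\mathcal{X}\times\mathcal{U}$ for $k=0,\dots,N-1$; $x(N)\in\mathcal{X}_{\mathrm f}$. Set $J(x,\bm{\delta})=\infty$ if infeasible. Let $J(x)=\min_{\bm{\delta}}J(x,\bm{\delta})$ and let $\bm{\delta}^\ast(x)$ be a minimizing $\bm{\delta}$ when $J(x)<\infty$. Let $J_{\mathrm t}(x)$ be defined like $J(x)$ but with $\mathcal{X}$ replaced by $\mathcal{X}\ominus\mathcal{O}$ in the constraint $(x(k),u(k))\in\mathcal{X}\times\mathcal{U}$ and $\mathcal{X}_{\mathrm f}$ replaced by $\mathcal{X}_{\mathrm f}\ominus\mathcal{O}$, where $\mathcal{O}$ is a fixed (arbitrarily small) set containing the origin; $J_{\mathrm t}(x)=\infty$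 if infeasible. Cost. $J(\mathbf{x},\mathbf{u})=\sum_{k=0}^{N-1}\big(\|Qx(k)\|_{p_1}+\|Ru(k)\|_{p_2}\big)+\|Px(N)\|_{p_3}$ with $p_1,p_2,p_3\in\{1,\infty\}$ and $Q,R,P$ real matrices with $n,m,n$ columns and rank $n,m,n$, respectively (the weight $P$ is unrelated to the regions $P_i$). Classifier. Let $\mathcal{L}_i=\{\bm{\delta}\in\{1,\dots,l\}^{N+1}\mid\delta(0)=i\}$. For parameters $\theta$, the policy is $\pi_\theta(x)=\phi_{\theta,i}(f_{\theta,i}(x))$ for $x\in P_i$, where for each $i\in\mathcal{L}$: $\mathcal{F}_{\theta,i}=\{\mathcal{R}_{i,1},\dots,\mathcal{R}_{i,\bar R_i}\}$ is a finite convex partition of $P_i$; $f_{\theta,i}:P_i\to\mathcal{F}_{\theta,i}$ sends $x$ to the element of the partition containing $x$; and $\phi_{\theta,i}:\mathcal{F}_{\theta,i}\to\mathcal{L}_i\cup\{-1\}$ ($-1$ meaning ''infeasible''). Training procedure (Algorithm 1). Start with a set $\mathcal{T}$ of labelled states. Repeat: (i) obtain $\theta$ by applying an arbitrary supervised learning routine to $\mathcal{T}$, producing a classifier of the form $\pi_\theta(x)=\phi_{\theta,i}(f_{\theta,i}(x))$ for $x\in P_i$, where, for each $i\in\mathcal{L}$, $\mathcal{F}_{\theta,i}$ is a finite convex partition of $P_i$, $f_{\theta,i}:P_i\to\mathcal{F}_{\theta,i}$ sends $x$ to the element of $\mathcal{F}_{\theta,i}$ containing $x$, and $\phi_{\theta,i}$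 maps $\mathcal{F}_{\theta,i}$ to $\mathcal{L}_i\cup\{-1\}$; (ii) for every $i\in\mathcal{L}$, every $\mathcal{R}\in\mathcal{F}_{\theta,i}$ and every $v\in\mathrm{Vert}(\mathcal{R})$, declare $v$ a violation if either $\phi_{\theta,i}(\mathcal{R})=-1$ and $J_{\mathrm t}(v)<\infty$, or $\phi_{\theta,i}(\mathcal{R})\neq-1$ and $J(v,\phi_{\theta,i}(\mathcal{R}))=\infty$; (iii) if there is no violation, return $\pi_\theta$ and stop; otherwise, for every violating $v$ add to $\mathcal{T}$ the pair $(v,\bm{\delta}^\ast(v))$ if $J(v)<\infty$ and $(v,-1)$ if $J(v)=\infty$, and repeat. *)

(* Defs.v *)
From HB Require Import structures.
From mathcomp Require Import all_boot all_order all_algebra.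
From mathcomp Require Import all_classical all_reals all_analysis.

Set Implicit Arguments.
Unset Strict Implicit.
Unset Printing Implicit Defensive.

Import Order.TTheory GRing.Theory Num.Theory.
Import numFieldNormedType.Exports.

Local Open Scope classical_set_scope.
Local Open Scope ring_scope.

Section Polytopes.
Context {R : realType} {n : nat}.
Implicit Types S T : set 'cV[R]_n.

Definition halfspace S : Prop :=
  exists (a : 'rV[R]_n) (b : R), a != 0 /\
    (S = [set x | (a *m x) 0 0 <= b] \/ S = [set x | (a *m x) 0 0 < b]).

(* Not necessarily bounded or closed. *)
Definition polytope S : Prop :=
  exists (k : nat) (H : 'I_k -> set 'cV[R]_n),
    (forall j, halfspace (H j)) /\ S = \bigcap_(j in setT) H j.

Definition convex_partition (I : Type) (D : set I) (F : I -> set 'cV[R]_n) S :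
  Prop :=
  partition D F S /\ (forall i, D i -> polytope (F i)).

Definition extreme_points S : set 'cV[R]_n :=
  [set x | S x /\
    forall y z (t : R), S y -> S z -> 0 < t -> t < 1 ->
      x = t *: y + (1 - t) *: z -> y = x /\ z = x].

Definition Vert S : set 'cV[R]_n := extreme_points (closure S).

Definition pontryagin S T : set 'cV[R]_n := [set x | forall t, T t -> S (x + t)].

End Polytopes.

Record pwa_system (R : realType) (n m l : nat) := PwaSystem {
  dynA : 'I_l -> 'M[R]_n;
  dynB : 'M[R]_(n, m);
  dync : 'I_l -> 'cV[R]_n;
  region : 'I_l -> set 'cV[R]_n;
  stateX : set 'cV[R]_n;
  inputU : set 'cV[R]_m;
  terminalX : set 'cV[R]_n }.

Definition dyn (R : realType) (n m l : nat) (s : pwa_system R n m l)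
  (i : 'I_l) (x : 'cV[R]_n) (u : 'cV[R]_m) : 'cV[R]_n :=
  dynA s i *m x + dynB s *m u + dync s i.

Record pwa_assumptions (R : realType) (n m l : nat) (s : pwa_system R n m l) :
  Prop := PwaAssumptions {
  stateX_polytope : polytope (stateX s);
  stateX_compact : compact (stateX s);
  stateX_origin : interior (stateX s) 0;
  inputU_polytope : polytope (inputU s);
  inputU_compact : compact (inputU s);
  inputU_origin : interior (inputU s) 0;
  region_partition : convex_partition setT (region s) (stateX s);
  dyn_continuous : forall i j x u,
    closure (region s i) x -> closure (region s j) x ->
    dyn s i x u = dyn s j x u;
  terminalX_polytope : polytope (terminalX s);
  terminalX_sub : terminalX s `<=` stateX s;
  terminalX_origin : interior (terminalX s) 0;
  terminalX_invariant : forall i, region s i `&` terminalX s !=set0 ->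
    exists K : 'M[R]_(m, n), forall x, region s i x -> terminalX s x ->
      inputU s (K *m x) /\ terminalX s (dyn s i x (K *m x));
  terminalX_closed : closed (terminalX s) }.

Variant pindex := P_one | P_inf.

(* The norm `|x| on matrices is the maximum of the moduli of the entries. *)
Definition pnorm (R : realType) (p : pindex) (q : nat) (x : 'cV[R]_q) : R :=
  if p is P_one then \sum_(i < q) `|x i 0| else `|x|.

Record stage_cost (R : realType) (n m : nat) := StageCost {
  rowsQ : nat;
  rowsR : nat;
  rowsP : nat;
  weightQ : 'M[R]_(rowsQ, n);
  weightR : 'M[R]_(rowsR, m);
  weightP : 'M[R]_(rowsP, n);
  weightQ_rank : \rank weightQ = n;
  weightR_rank : \rank weightR = m;
  weightP_rank : \rank weightP = n;
  indexQ : pindex;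
  indexR : pindex;
  indexP : pindex }.

Definition switching (N l : nat) := {ffun 'I_N.+1 -> 'I_l}.

Section OptimalControl.
Context {R : realType} {n m l : nat}.
Variables (s : pwa_system R n m l) (g : stage_cost R n m) (N : nat).
Implicit Types (X Xf O : set 'cV[R]_n) (x : 'cV[R]_n) (d : switching N l).

Let cur (k : 'I_N) : 'I_N.+1 := widen_ord (leqnSn N) k.
Let nxt (k : 'I_N) : 'I_N.+1 := lift ord0 k.

Definition total_cost (xs : 'I_N.+1 -> 'cV[R]_n) (us : 'I_N -> 'cV[R]_m) : R :=
  \sum_(k < N) (pnorm (indexQ g) (weightQ g *m xs (cur k))
                + pnorm (indexR g) (weightR g *m us k))
  + pnorm (indexP g) (weightP g *m xs ord_max).

Definition admissible X Xf x d
  (xs : 'I_N.+1 -> 'cV[R]_n) (us : 'I_N -> 'cV[R]_m) : Prop :=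
  [/\ xs ord0 = x,
      forall k : 'I_N, xs (nxt k) = dyn s (d (cur k)) (xs (cur k)) (us k),
      forall k : 'I_N.+1, closure (region s (d k)) (xs k),
      forall k : 'I_N, X (xs (cur k)) /\ inputU s (us k)
    & Xf (xs ord_max)].

(* The infimum over the empty set is +oo, which encodes infeasibility; when the
   constraint sets are compact, a nonempty infimum is attained. *)
Definition cost_switching X Xf x d : \bar R :=
  ereal_inf [set r | exists xs us,
    admissible X Xf x d xs us /\ r = (total_cost xs us)%:E].

Definition cost_min X Xf x : \bar R :=
  \big[Order.min/+oo%E]_(d : switching N l) cost_switching X Xf x d.

Definition Jd x d : \bar R := cost_switching (stateX s) (terminalX s) x d.

Definition J x : \bar R := cost_min (stateX s) (terminalX s) x.

Definition Jt O x : \bar R :=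
  cost_min (pontryagin (stateX s) O) (pontryagin (terminalX s) O) x.

Definition optimal_switching (dstar : 'cV[R]_n -> switching N l) : Prop :=
  forall x, (J x < +oo)%E -> Jd x (dstar x) = J x.

(* The label None stands for -1 ("infeasible"). *)
Definition label := option (switching N l).

(* The values of clf_f i outside of the region P_i, and of clf_phi i outside of
   the partition clf_F i, are irrelevant. *)
Record classifier := Classifier {
  clf_F : 'I_l -> set (set 'cV[R]_n);
  clf_f : 'I_l -> 'cV[R]_n -> set 'cV[R]_n;
  clf_phi : 'I_l -> set 'cV[R]_n -> label;
  clf_F_finite : forall i, finite_set (clf_F i);
  clf_F_partition : forall i, convex_partition (clf_F i) id (region s i);
  clf_f_mem : forall i x, region s i x -> clf_F i (clf_f i x) /\ clf_f i x x;
  clf_phi_first : forall i C d, clf_F i C -> clf_phi i C = Some d -> d ord0 = i }.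

(* The regions are pairwise disjoint, so the index picked is the only one. *)
Definition policy (c : classifier) x : label :=
  if [pick i | `[< region s i x >]] is Some i then clf_phi c i (clf_f c i x)
  else None.

Definition policy_domain (c : classifier) : set 'cV[R]_n :=
  [set x | stateX s x /\ policy c x <> None].

Definition violation O (c : classifier) : set 'cV[R]_n :=
  [set v | exists i C, [/\ clf_F c i C, Vert C v &
    (clf_phi c i C = None /\ (Jt O v < +oo)%E) \/
    (exists2 d, clf_phi c i C = Some d & Jd v d = +oo%E)]].

Definition training_set := set ('cV[R]_n * label).

Definition augment O (dstar : 'cV[R]_n -> switching N l) (T : training_set)
  (c : classifier) : training_set :=
  T `|` [set p | violation O c p.1 /\
                 p.2 = if (J p.1 < +oo)%E then Some (dstar p.1) else None].

(* The relation learn T theta holds when theta is a possible outcome of the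
   learning routine on T; returned T theta holds when the procedure started from
   T stops and returns theta. *)
Inductive returned O (dstar : 'cV[R]_n -> switching N l) (Theta : Type)
  (clf : Theta -> classifier) (learn : training_set -> Theta -> Prop) :
  training_set -> Theta -> Prop :=
| returned_stop T theta :
    learn T theta -> violation O (clf theta) = set0 ->
    returned O dstar clf learn T theta
| returned_continue T theta theta' :
    learn T theta -> violation O (clf theta) !=set0 ->
    returned O dstar clf learn (augment O dstar T (clf theta)) theta' ->
    returned O dstar clf learn T theta'.

End OptimalControl.

(* Main.v *)
(* For a fixed switching sequence d the constraints are jointly convex in the
   state and input trajectories, so the set of x with J(x, d) < oo is convex. A
   cell C labelled d has compact closure, being contained in X, so every point
   of C is a convex combination of vertices of C; as no vertex is a violation,
   all of them are feasible for d. *)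
Require Import Defs.
From mathcomp Require Import all_boot all_order all_algebra.
From mathcomp Require Import all_classical all_reals all_analysis.
From mathcomp Require Import ring lra.

Import Order.TTheory GRing.Theory Num.Theory.
Import numFieldNormedType.Exports.

Local Open Scope classical_set_scope.
Local Open Scope ring_scope.

Lemma conv_le_max {R : realDomainType} (u v t : R) :
  0 <= t -> t <= 1 -> t * u + (1 - t) * v <= Num.max u v.
Proof.
move=> t0 t1; have : u <= Num.max u v by rewrite le_max lexx.
have : v <= Num.max u v by rewrite le_max lexx orbT.
set M := Num.max u v => vM uM.
have : 0 <= t * (M - u) by rewrite mulr_ge0 ?subr_ge0.
have : 0 <= (1 - t) * (M - v) by rewrite mulr_ge0 ?subr_ge0.
nra.
Qed.

(** * Convexity of polytopes, and closures of polytopes as systems of non-strict linear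
    inequalities *)

Section Polyhedra.
Context {R : realType} {n : nat}.
Implicit Types (x y w : 'cV[R]_n) (S D : set 'cV[R]_n).

(** Trades the bundled unit-interval weights of the convex-space structure for a plain real [t] with
    two inequalities. *)
Lemma convex_setP S :
  convex_set (S : set (convex_lmodType 'cV[R]_n)) <->
  forall x y (t : R), S x -> S y -> 0 <= t -> t <= 1 ->
    S (t *: x + (1 - t) *: y).
Proof.
split=> [cS x y t Sx Sy t0 t1|cS].
  have := cS x y (Itv01 t0 t1); rewrite !inE; exact.
by move=> x y t; rewrite !inE => Sx Sy; apply: cS.
Qed.

Lemma mulmx_line (a : 'rV[R]_n) x w (s : R) :
  (a *m (x + s *: w)) 0 0 = (a *m x) 0 0 + s * (a *m w) 0 0.
Proof. by rewrite mulmxDr -scalemxAr !mxE. Qed.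

Lemma mulmx_sub (a : 'rV[R]_n) x y :
  (a *m (x - y)) 0 0 = (a *m x) 0 0 - (a *m y) 0 0.
Proof. by rewrite mulmxBr !mxE. Qed.

Lemma mulmx_conv (a : 'rV[R]_n) x y (t : R) :
  (a *m (t *: x + (1 - t) *: y)) 0 0
  = t * (a *m x) 0 0 + (1 - t) * (a *m y) 0 0.
Proof. by rewrite mulmxDr -!scalemxAr !mxE. Qed.

Lemma continuous_rowmul (a : 'rV[R]_n) : continuous (fun x => (a *m x) 0 0).
Proof.
under eq_fun do rewrite mxE.
have addC : continuous (fun p : R * R => p.1 + p.2) by exact: add_continuous.
move=> x; apply: (@cvg_big _ _ _ (0 : R) xpredT addC _ (nbhs x) _
  (fun j y => a 0 j * y j 0) (fun j => a 0 j * x j 0)) => j _.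
apply: cvgM; first exact: cvg_cst.
exact: coord_continuous.
Qed.

Definition polyhedron {k : nat} (a : 'I_k -> 'rV[R]_n) (b : 'I_k -> R) :
  set 'cV[R]_n := [set x | forall j, (a j *m x) 0 0 <= b j].

Lemma closed_polyhedron k (a : 'I_k -> 'rV[R]_n) b : closed (polyhedron a b).
Proof.
have -> : polyhedron a b =
    \bigcap_(j in setT) (fun x => (a j *m x) 0 0) @^-1` [set r | r <= b j].
  by apply/seteqP; split=> [x Px j _|x Px j]; [exact: Px|exact: Px j I].
apply: closed_bigI => j _; apply: preimage_closed; last exact: closed_le.
by move=> x _; exact: continuous_rowmul.
Qed.

Lemma convex_polyhedron k (a : 'I_k -> 'rV[R]_n) b :
  convex_set (polyhedron a b : set (convex_lmodType 'cV[R]_n)).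
Proof.
apply/convex_setP => x y t Px Py t0 t1 j; rewrite mulmx_conv.
by apply: le_trans (conv_le_max _ _ _ t0 t1) _; rewrite ge_max Px Py.
Qed.

Lemma convex_halfspace S :
  halfspace S -> convex_set (S : set (convex_lmodType 'cV[R]_n)).
Proof.
case=> a [b] [_ [->|->]]; apply/convex_setP => x y t /= Sx Sy t0 t1;
  rewrite mulmx_conv.
- by apply: le_trans (conv_le_max _ _ _ t0 t1) _; rewrite ge_max Sx Sy.
- by apply: le_lt_trans (conv_le_max _ _ _ t0 t1) _; rewrite gt_max Sx Sy.
Qed.

Lemma convex_polytope S :
  polytope S -> convex_set (S : set (convex_lmodType 'cV[R]_n)).
Proof.
case=> k [H] [hH ->]; apply/convex_setP => x y t Sx Sy t0 t1 j _.
by apply: (convex_setP _).1 => //; [exact: convex_halfspace|exact: Sx|exact: Sy].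
Qed.

(** The closure arises by relaxing each strict inequality. Nonemptiness matters: no real satisfies
    both [r < 0] and [0 < r], yet the relaxed system has the solution 0. *)
Lemma closure_polytope S : polytope S -> S !=set0 ->
  exists k (a : 'I_k -> 'rV[R]_n) b, closure S = polyhedron a b.
Proof.
case=> k [H] [hH ->] [c Sc].
have ex_ab j : exists ab : 'rV[R]_n * R,
    H j = [set x | (ab.1 *m x) 0 0 <= ab.2] \/
    H j = [set x | (ab.1 *m x) 0 0 < ab.2].
  by have [a [b [_ ?]]] := hH j; exists (a, b).
have [ab hab] := choice ex_ab.
exists k, (fun j => (ab j).1), (fun j => (ab j).2); apply/seteqP; split.
  rewrite [X in _ `<=` X](closure_id _).1; last exact: closed_polyhedron.
  apply: closureS => x Sx j; have := Sx j I.
  by case: (hab j) => -> //=; exact: ltW.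
move=> x Px.
(* x is approached along the segment towards c, which satisfies the strict
   inequalities. *)
have lim : (fun t : R => x + t *: (c - x)) @ 0^'+ --> x.
  rewrite -[X in _ --> X]addr0; apply: cvgD; first exact: cvg_cst.
  rewrite -(scale0r (c - x)); apply: cvgZr_tmp.
  exact: cvg_at_right_filter cvg_id.
apply: (closed_cvg (closure _) (@closed_closure _ _) _ x lim).
near=> t; apply: subset_closure => j _.
have t0 : 0 < t by near: t; exact: nbhs_right_gt.
have t1 : t <= 1 by near: t; exact: nbhs_right_le.
have := Sc j I; have := Px j.
case: (hab j) => -> /= xb cb; rewrite mulmx_line mulmx_sub; nra.
Unshelve. all: by end_near. Qed.

Lemma convex_closure_polytope S : polytope S ->
  convex_set (closure S : set (convex_lmodType 'cV[R]_n)).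
Proof.
move=> pS; have [->|/set0P S0] := eqVneq S set0.
  by rewrite closure0; apply/convex_setP.
by have [k [a [b ->]]] := closure_polytope _ pS S0; exact: convex_polyhedron.
Qed.

(** * Minkowski's theorem for bounded polyhedra *)

Section Hull.
Context {k : nat} (a : 'I_k -> 'rV[R]_n) (b : 'I_k -> R).
Hypothesis bP : bounded_set (polyhedron a b).

(** On the polyhedron these are the constraints that are not tight; their number is the induction
    measure below. *)
Definition slack x := [set j | (a j *m x) 0 0 < b j]%SET.

(** Otherwise the whole ray from [x] along [w] would stay in the polyhedron. *)
Lemma bounded_polyhedron_exit x w : polyhedron a b x -> w != 0 ->
  exists j, 0 < (a j *m w) 0 0.
Proof.
move=> Px w0; apply: contrapT => /forallNP noj.
have [M [_ /(_ (M + 1))]] := bP; rewrite ltrDl ltr01 => /(_ isT) hM.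
have w_gt0 : 0 < `|w| by rewrite normr_gt0.
(* This length makes the norm of [s *: w] equal to [M + 2 + |x|], so [x + s *: w] has norm at least
   [M + 2], beyond the bound [M + 1]. *)
pose s := (M + 2 + `|x|) / `|w|.
have M0 : 0 <= M + 1 by apply: le_trans (normr_ge0 x) (hM _ Px).
have s0 : 0 <= s by apply: divr_ge0 => //; have := normr_ge0 x; lra.
have /hM /= : polyhedron a b (x + s *: w).
  move=> j; rewrite mulmx_line; have := Px j; have /negP := noj j.
  by rewrite -leNgt; nra.
have : `|s *: w| <= `|x + s *: w| + `|x|.
  by rewrite -{1}[s *: w](addKr x) addrC; apply: le_trans (ler_normB _ _) _.
rewrite normrZ ger0_norm // /s divfK ?gt_eqF //; lra.
Qed.

(** A ratio test: [r j] is the step at which constraint [j] becomes tight along [w], and the least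
    one over the constraints increasing along [w] keeps the point inside. Constraints tight at [x]
    stay tight, and the minimizer [j0] joins them. *)
Lemma polyhedron_boundary x w : polyhedron a b x -> w != 0 ->
  (forall j, (a j *m x) 0 0 = b j -> (a j *m w) 0 0 = 0) ->
  exists s : R, [/\ 0 < s, polyhedron a b (x + s *: w) &
    (#|slack (x + s *: w)| < #|slack x|)%N].
Proof.
move=> Px w0 tight; have [j1 j1P] := bounded_polyhedron_exit _ _ Px w0.
pose r j := (b j - (a j *m x) 0 0) / (a j *m w) 0 0.
case: (@Order.TotalTheory.arg_minP _ _ _ j1
  (fun j => 0 < (a j *m w) 0 0) r j1P) => j0 j0P j0min.
have slack0 : (a j0 *m x) 0 0 < b j0.
  rewrite lt_neqAle Px andbT; apply/eqP => /tight j0w.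
  by rewrite j0w ltxx in j0P.
have s0 : 0 < r j0 by rewrite divr_gt0 // subr_gt0.
exists (r j0); split=> //.
  move=> j; rewrite mulmx_line; have [jP|jN] := ltP 0 ((a j *m w) 0 0).
    by have := j0min j jP; rewrite {2}/r ler_pdivlMr //; lra.
  have := Px j; nra.
apply/proper_card/properP; split.
  apply/fintype.subsetP => j; rewrite !inE mulmx_line => jP.
  rewrite lt_neqAle Px andbT; apply/eqP => jx.
  by rewrite tight // mulr0 addr0 jx ltxx in jP.
exists j0; first by rewrite inE.
by rewrite inE mulmx_line /r divfK ?gt_eqF // addrC subrK ltxx.
Qed.

(* Minkowski's theorem, by induction on the number of slack
   constraints at x: when x is not extreme, it lies on a segment of the
   polyhedron whose two end points each make a further constraint tight. *)
Lemma polyhedron_sub_convex D :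
  convex_set (D : set (convex_lmodType 'cV[R]_n)) ->
  extreme_points (polyhedron a b) `<=` D -> polyhedron a b `<=` D.
Proof.
move=> /convex_setP cD eD x.
have [N leN] := ubnP #|slack x|; elim: N x leN => // N IH x leN Px.
have [/eD|next] := pselect (extreme_points (polyhedron a b) x); first by [].
have [y [z [t [[Py Pz t0 t1] [xE yz]]]]] : exists y z (t : R),
    [/\ polyhedron a b y, polyhedron a b z, 0 < t & t < 1] /\
    x = t *: y + (1 - t) *: z /\ y != z.
  apply: contrapT => nseg; apply: next; split=> // y z t Py Pz t0 t1 xE.
  have [yz|yz] := eqVneq y z; last first.
    by case: nseg; exists y, z, t; split=> //; split.
  by rewrite xE -yz -scalerDl addrC subrK scale1r.
(* A linear form that attains its upper bound strictly inside a segment attains it at both ends. *)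
have tight j : (a j *m x) 0 0 = b j -> (a j *m (y - z)) 0 0 = 0.
  rewrite xE mulmx_conv mulmx_sub; have := Py j; have := Pz j; nra.
have w0 : y - z != 0 by rewrite subr_eq0.
have [s1 [s1_gt0 P1 lt1]] := polyhedron_boundary _ _ Px w0 tight.
have [||s2 [s2_gt0 P2 lt2]] := polyhedron_boundary x (- (y - z)) Px.
- by rewrite oppr_eq0.
- by move=> j /tight; rewrite mulmxN [RHS]/= => wj; rewrite [LHS]mxE wj oppr0.
have D1 := IH _ (leq_trans lt1 leN) P1.
have D2 := IH _ (leq_trans lt2 leN) P2.
have s_gt0 : 0 < s1 + s2 by exact: addr_gt0.
(* The weight for which the displacements [s1] and [s2] in opposite directions cancel. *)
pose p := s2 / (s1 + s2).
have p0 : 0 <= p by rewrite divr_ge0 // ltW.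
have p1 : p <= 1 by rewrite ler_pdivrMr // mul1r lerDr ltW.
have ps : p * s1 - (1 - p) * s2 = 0.
  by rewrite /p; field; rewrite gt_eqF.
suff <- : p *: (x + s1 *: (y - z)) + (1 - p) *: (x + s2 *: - (y - z)) = x.
  exact: cD.
move: (y - z) => w; rewrite !scalerDr !scalerN !scalerA addrACA -scalerDl.
by rewrite [p + _]addrC subrK scale1r -scalerBl ps scale0r addr0.
Qed.

End Hull.
End Polyhedra.

(** * Feasible states of a fixed switching sequence *)

Section Feasibility.
Context {R : realType} {n m l N : nat}.
Variables (s : pwa_system R n m l) (g : stage_cost R n m).

Definition feasible (x : 'cV[R]_n) (d : switching N l) : Prop :=
  exists xs us, admissible s (stateX s) (terminalX s) x d xs us.

(** Each trajectory has a real cost, so the infimum is [+oo] only over the empty set. *)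
Lemma Jd_ltP x (d : switching N l) : (Jd s g x d < +oo)%E <-> feasible x d.
Proof.
split=> [Jx|[xs [us adm]]].
  apply: contrapT => infeas; move: Jx.
  rewrite /Jd /cost_switching [X in ereal_inf X](_ : _ = set0).
    by rewrite ereal_inf0 ltxx.
  by apply/seteqP; split=> // r [xs [us [adm _]]]; case: infeas; exists xs, us.
apply: le_lt_trans (ltry (total_cost g xs us)).
by apply: ereal_inf_lbound; exists xs, us.
Qed.

(** The weights sum to 1, so the constant term of the affine map splits along with the linear
    ones. *)
Lemma dyn_conv i (x y : 'cV[R]_n) (u v : 'cV[R]_m) (t : R) :
  dyn s i (t *: x + (1 - t) *: y) (t *: u + (1 - t) *: v)
  = t *: dyn s i x u + (1 - t) *: dyn s i y v.
Proof.
rewrite /dyn !mulmxDr -!scalemxAr !scalerDr.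
have {1}-> : dync s i = t *: dync s i + (1 - t) *: dync s i.
  by rewrite -scalerDl addrC subrK scale1r.
by rewrite [X in X + _ = _]addrACA [LHS]addrACA.
Qed.

Lemma convex_feasible (hs : pwa_assumptions s) (d : switching N l) :
  convex_set ([set x | feasible x d] : set (convex_lmodType 'cV[R]_n)).
Proof.
have /convex_setP cX := convex_polytope _ (stateX_polytope hs).
have /convex_setP cU := convex_polytope _ (inputU_polytope hs).
have /convex_setP cXf := convex_polytope _ (terminalX_polytope hs).
have cP i : convex_set
    (closure (region s i) : set (convex_lmodType 'cV[R]_n)).
  by apply: convex_closure_polytope; have [_ ] := region_partition hs; exact.
apply/convex_setP => x y t [xs [us [x0 xS xP xU xf]]].
move=> [ys [vs [y0 yS yP yU yf]]] t0 t1.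
(* Both trajectories follow the same [d], so at each time they share one affine map and one convex
   region closure. *)
exists (fun k => t *: xs k + (1 - t) *: ys k).
exists (fun k => t *: us k + (1 - t) *: vs k); split.
- by rewrite x0 y0.
- by move=> k; rewrite dyn_conv xS yS.
- by move=> k; have /convex_setP := cP (d k); exact.
- move=> k; have [xX uU] := xU k; have [yX vU] := yU k.
  by split; [exact: cX|exact: cU].
- exact: cXf.
Qed.

End Feasibility.

Theorem proposition3 (R : realType) (n m l N : nat) (N_ge1 : (1 <= N)%N)
  (s : pwa_system R n m l) (hs : pwa_assumptions s) (g : stage_cost R n m)
  (O : set 'cV[R]_n) (O_origin : O 0)
  (dstar : 'cV[R]_n -> switching N l) (hdstar : optimal_switching s g dstar)
  (Theta : Type) (clf : Theta -> classifier s N)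
  (learn : training_set (R := R) (n := n) (l := l) N -> Theta -> Prop)
  (T0 : training_set (R := R) (n := n) (l := l) N) (theta : Theta)
  (hret : returned g O dstar clf learn T0 theta) :
  forall x, policy_domain (clf theta) x ->
    exists2 d, policy (clf theta) x = Some d & (Jd s g x d < +oo)%E.
Proof.
(* By induction on the run: only the stopping rule yields a classifier, and it requires that there
   be no violation. *)
have noviol : violation g O (clf theta) = set0.
  by elim: hret.
move=> x [Xx]; rewrite /policy.
(* Outside all regions the policy defaults to [None], which [policy_domain] excludes. *)
case: pickP => [i /asboolP Pix|//].
have [FC Cx] := clf_f_mem (clf theta) Pix.
set C := clf_f _ _ _ in FC Cx *.
case phiC : (clf_phi _ _ _) => [d|//] _; exists d => //.
apply/Jd_ltP.
have [[cover_i _ _] polyF] := clf_F_partition (clf theta) i.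
have CX : closure C `<=` stateX s.
  rewrite [X in _ `<=` X](closure_id _).1; last first.
    by apply: compact_closed (stateX_compact hs); exact: norm_hausdorff.
  apply: closureS => y Cy; have [[<- _ _] _] := region_partition hs.
  by exists i => //; rewrite -cover_i; exists C.
have [k [a [b clC]]] := closure_polytope _ (polyF _ FC) (ex_intro _ x Cx).
(* Minkowski's theorem is applied to [closure C] rather than [C], since [Vert C] consists of the
   extreme points of the closure. *)
apply: (@polyhedron_sub_convex _ _ _ a b _ [set y | feasible s y d]).
- rewrite -clC; have [M [Mr HM]] := compact_bounded (stateX_compact hs).
  by exists M; split=> // M' MM' y /CX; exact: HM.
- exact: convex_feasible.
- rewrite -clC => v vC; apply/(Jd_ltP s g); rewrite ltey; apply/eqP => Jv.
  suff : violation g O (clf theta) v by rewrite noviol.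
  by exists i, C; split=> //; right; exists d.
- by rewrite -clC; exact: subset_closure Cx.
Qed.
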